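(* Let $a\ge 2$ be an integer and let $K$ be a colored regularity graph on $n$ vertices with the property that any set $A$ of $a$ vertices of $K$ satisfies at least one of the following conditions: (1) $A$ contains at least one white edge; (2) $A$ contains a spanning subgraph of black edges. Then $$(a-1)|\mathrm{EW}(K)|+|\mathrm{EB}(K)|\ge\left\lceil\frac{n}{2}(n-a+1)\right\rceil.$$
   Context: A colored regularity graph (CRG) $K$ is a finite complete graph together with a partition of its vertices into white and black vertices and a partition of its edges $E(K)=\mathrm{EW}(K)\,\dot\cup\,\mathrm{EG}(K)\,\dot\cup\,\mathrm{EB}(K)$ into white, gray and black edges. Condition (1) means some edge of $K$ with both endpoints in $A$ is white. Condition (2) means that the black edges with both endpoints in $A$ cover $A$, i.e. every vertex of $A$ is incident to a black edge whose other endpoint is also in $A$. *)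

(* Defs.v *)
From HB Require Import structures.
From mathcomp Require Import all_boot all_order all_algebra.

Set Implicit Arguments.
Unset Strict Implicit.
Unset Printing Implicit Defensive.

Variant vertex_color := VWhite | VBlack.

Variant edge_color := EWhite | EGray | EBlack.

Definition edge_color_code (c : edge_color) : option bool :=
  match c with EWhite => Some true | EGray => None | EBlack => Some false end.

Definition edge_color_decode (o : option bool) : edge_color :=
  match o with Some true => EWhite | None => EGray | Some false => EBlack end.

Lemma edge_color_codeK : cancel edge_color_code edge_color_decode.
Proof. by case. Qed.

HB.instance Definition _ := Equality.copy edge_color (can_type edge_color_codeK).

(* The underlying graph is the complete graph on V, and an edge is a
   two-element set of vertices.  Partitions (with possibly empty parts) are
   encoded as colorings; the value of [ecolor] on a set that is not an edge
   is irrelevant, since [EW], [EG] and [EB] only collect edges. *)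
Record crg (V : finType) := CRG {
  vcolor : V -> vertex_color;
  ecolor : {set V} -> edge_color
}.

Definition edges (V : finType) : {set {set V}} := [set e : {set V} | #|e| == 2].

Section EdgeClasses.
Variables (V : finType) (K : crg V).

Definition EW : {set {set V}} := [set e in edges V | ecolor K e == EWhite].
Definition EG : {set {set V}} := [set e in edges V | ecolor K e == EGray].
Definition EB : {set {set V}} := [set e in edges V | ecolor K e == EBlack].

Definition has_white_edge (A : {set V}) : Prop :=
  exists2 e : {set V}, e \in EW & e \subset A.

Definition has_black_spanning (A : {set V}) : Prop :=
  cover [set e in EB | e \subset A] = A.

End EdgeClasses.

(* Main.v *)
Require Import Defs.
From mathcomp Require Import all_boot all_order all_algebra.
From mathcomp Require Import zify lra.
Import Order.TTheory GRing.Theory Num.Theory.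

(** A weighted form of the greedy proof of Turan's theorem.  Give a white edge
    weight [a - 1], a black edge weight [1] and a gray edge weight [0]; doubling
    the claim, the sum of the weights over ordered pairs must be at least
    [n * (n - (a - 1))]; differences here are integers, possibly negative.

    The hypothesis enters only through a set [J] without white edges: a vertex
    [u] of [J] has at most [a - 1] vertices of [J], itself included, that are
    not joined to it by a black edge, for otherwise [a] of them would form a set
    violating both alternatives ([card_white_free]).

    Remove from the current vertex set [S] a maximal subset [I] without white
    edges, and let [T] be the rest.  By the bound above each vertex of [I] has
    weighted degree at least [#|I| - (a - 1)] into [I].  A vertex [u] of [T] has
    at least one white neighbour in [I] by maximality; deleting all [k] of them
    and adding [u] gives another set without white edges, so [u] has at least
    [#|I| - k + 1 - (a - 1)] black neighbours in [I].  As [k >= 1], the weighted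
    degree of [u] into [I] is at least [#|I|] ([degree_to_maximal]).  With
    [m = #|T|] the three parts of the sum over [S = I + T] add up exactly:
      [#|I| * (#|I| - (a - 1)) + 2 * m * #|I| + m * (m - (a - 1))
         = (#|I| + m) * (#|I| + m - (a - 1))],
    so induction on [#|S|] closes ([weight_lower_bound]). *)

(** * Weighted degrees for a pair of relations *)

Section WeightedTuran.
Set Implicit Arguments.
Unset Strict Implicit.

Variables (V : finType) (a : nat) (white black : rel V).
Hypotheses (white_sym : symmetric white) (black_sym : symmetric black).
Hypotheses (white_irr : irreflexive white) (black_irr : irreflexive black).

Definition white_free (A : {set V}) :=
  [forall x in A, forall y in A, ~~ white x y].

Hypothesis black_cover : forall A : {set V}, #|A| = a -> white_free A ->
  forall x, x \in A -> exists2 y, y \in A & black x y.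
Hypothesis a_ge2 : 2 <= a.

Definition weight (u v : V) : nat := (a - 1) * white u v + black u v.

Lemma white_freeP (A : {set V}) :
  reflect {in A &, forall x y, ~~ white x y} (white_free A).
Proof.
apply: (iffP 'forall_in_forall_inP) => H x; first by move=> y xA yA; exact: H.
by move=> xA y yA; exact: H.
Qed.

Lemma white_freeS (A B : {set V}) : A \subset B -> white_free B -> white_free A.
Proof.
move=> /subsetP AB /white_freeP fB; apply/white_freeP => x y xA yA.
by apply: fB; exact: AB.
Qed.

Lemma weight_sym u v : weight u v = weight v u.
Proof. by rewrite /weight white_sym black_sym. Qed.

Lemma sum_weight u (I : {set V}) :
  \sum_(v in I) weight u v =
    (a - 1) * #|[set v in I | white u v]| + #|[set v in I | black u v]|.
Proof.
rewrite big_split -big_distrr /=; congr (_ * _ + _);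
  by rewrite -sum1dep_card [in RHS]big_mkcondr; apply: eq_bigr => v _; case: ifP.
Qed.

(** Were there [a] vertices of [J], one of them [u], not joined to [u] by a
    black edge, these [a] vertices would contradict [black_cover]. *)
Lemma card_white_free (J : {set V}) u : white_free J -> u \in J ->
  #|J| <= #|[set v in J | black u v]| + (a - 1).
Proof.
move=> fJ uJ; pose N := [set v in J | ~~ black u v].
have -> : #|J| = #|[set v in J | black u v]| + #|N|.
  rewrite -(cardsID [set v | black u v] J); congr (_ + _); apply: eq_card => v.
    by rewrite !inE.
  by rewrite !inE andbC.
rewrite leq_add2l leqNgt; apply/negP => ltN.
have uN : u \in N by rewrite inE uJ black_irr.
have cN1 : a - 1 <= #|N :\ u| by have := cardsD1 u N; rewrite uN /=; lia.
have [s [s_uniq s_size sN]] := card_geqP cN1.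
have us : u \notin s by apply/negP => /sN; rewrite !inE eqxx.
pose A := [set x in u :: s].
have AN : A \subset N.
  apply/subsetP => x; rewrite !inE => /predU1P[->|/sN]; rewrite ?uJ ?black_irr //.
  by rewrite !inE => /andP[].
have cA : #|A| = a.
  have /card_uniqP : uniq (u :: s) by rewrite /= us.
  by rewrite cardsE /= s_size => ->; lia.
have fA : white_free A.
  apply: white_freeS fJ; apply: subset_trans AN _.
  by apply/subsetP => x; rewrite inE => /andP[].
have uA : u \in A by rewrite inE mem_head.
have [y yA buy] := black_cover cA fA uA.
by have := subsetP AN _ yA; rewrite inE buy andbF.
Qed.

(** With [k >= 1] white and [b] black neighbours of [u] in [I], exchanging the
    white neighbours for [u] gives [#|I| - k + 1 <= b + (a - 1)], that is
    [#|I| <= k + b + (a - 2)]; and [a - 2 <= (a - 2) * k].  This is where the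
    weight [a - 1] of a white edge comes from. *)
Lemma degree_to_maximal (S I : {set V}) u :
    maxset (fun A : {set V} => (A \subset S) && white_free A) I ->
    u \in S :\: I ->
  #|I| <= \sum_(v in I) weight u v.
Proof.
move=> /maxsetP[/andP[IS fI] maxI]; rewrite inE => /andP[uI uS].
rewrite sum_weight; set W := [set v in I | white u v].
set b := #|[set v in I | black u v]|.
(* Otherwise [I] could be enlarged by [u]. *)
have W_gt0 : 0 < #|W|.
  rewrite card_gt0; apply/negP => /eqP W0; case/negP: uI.
  have nW v : v \in I -> ~~ white u v.
    by move=> vI; have := in_set0 v; rewrite -W0 inE vI /= => ->.
  rewrite -[in X in _ \in X](maxI (u |: I)) ?setU11 ?subsetUr //.
  rewrite subUset sub1set uS IS /=; apply/white_freeP => x y.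
  rewrite !inE => /predU1P[->|xI] /predU1P[->|yI].
  - by rewrite white_irr.
  - exact: nW.
  - by rewrite white_sym; exact: nW.
  - exact: (white_freeP _ fI).
pose J := u |: (I :\: W).
have fJ : white_free J.
  have nW v : v \in I :\: W -> ~~ white u v.
    by rewrite !inE => /andP[+ vI]; rewrite vI.
  apply/white_freeP => x y /setU1P[->|xI] /setU1P[->|yI].
  - by rewrite white_irr.
  - exact: nW.
  - by rewrite white_sym; exact: nW.
  - by move: xI yI => /setDP[xI _] /setDP[yI _]; exact: (white_freeP _ fI).
have cJ : #|J| = (#|I| - #|W|).+1.
  rewrite cardsU1 !inE (negbTE uI) /= cardsD (setIidPr _) //.
  by apply/subsetP => v; rewrite inE => /andP[].
have leb : #|[set v in J | black u v]| <= b.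
  apply/subset_leq_card/subsetP => v; rewrite !inE => /andP[/predU1P[->|/andP[_ ->] //]].
  by rewrite black_irr.
have := card_white_free fJ (setU11 _ _); rewrite cJ; nia.
Qed.

(** The term [#|S| * (a - 1)] stands on the right to avoid truncated
    subtraction when [#|S| < a - 1], a case the induction does reach. *)
Theorem weight_lower_bound (S : {set V}) :
  #|S| * #|S| <= \sum_(u in S) \sum_(v in S) weight u v + #|S| * (a - 1).
Proof.
have [m] := ubnP #|S|; elim: m S => // m IHm S ltSm.
have [->|/set0Pn[x xS]] := eqVneq S set0; first by rewrite cards0.
pose P (A : {set V}) := (A \subset S) && white_free A.
have Px : P [set x].
  rewrite /P sub1set xS /=; apply/white_freeP => y z /set1P-> /set1P->.
  by rewrite white_irr.
have [I maxI xI] := maxset_exists Px.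
have /andP[IS fI] := maxsetp maxI.
pose T := S :\: I; pose w (A B : {set V}) := \sum_(u in A) \sum_(v in B) weight u v.
have I_gt0 : 0 < #|I| by rewrite (cardD1 x) -sub1set xI.
have cS : #|S| = #|I| + #|T| by rewrite -(cardsID I S) (setIidPr IS).
have wS : w S S = w I I + w T T + 2 * w T I.
  have split (A : {set V}) : w A S = w A I + w A T.
    rewrite /w -big_split; apply: eq_bigr => u _.
    by rewrite (big_setID I) /= (setIidPr IS).
  have wIT : w I T = w T I.
    rewrite /w exchange_big; apply: eq_bigr => u _; apply: eq_bigr => v _.
    exact: weight_sym.
  rewrite {1}/w (big_setID I) /= (setIidPr IS) -/(w I S) -/(w T S) !split wIT.
  lia.
have wI : #|I| * #|I| <= w I I + #|I| * (a - 1).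
  rewrite -!sum_nat_const -big_split; apply: leq_sum => u uI.
  apply: leq_trans (card_white_free fI uI) _.
  by rewrite leq_add2r sum_weight leq_addl.
have wTI : #|T| * #|I| <= w T I.
  rewrite -sum_nat_const; apply: leq_sum => u uT; exact: degree_to_maximal uT.
have wT : #|T| * #|T| <= w T T + #|T| * (a - 1) by apply: IHm; lia.
rewrite -/(w S S) wS cS; nia.
Qed.

End WeightedTuran.

(** * Sets of two-element sets as symmetric relations *)

Section EdgeRelation.
Variables (V : finType) (F : {set {set V}}).
Hypothesis F_edges : F \subset edges V.

Definition adj : rel V := fun u v => [set u; v] \in F.

Lemma adj_sym : symmetric adj.
Proof. by move=> u v; rewrite /adj setUC. Qed.

Lemma adj_irr : irreflexive adj.
Proof.
move=> u; apply/negP => /(subsetP F_edges).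
by rewrite inE setUid cards1.
Qed.

Lemma edge_at e x : e \in F -> x \in e -> exists2 y, e = [set x; y] & adj x y.
Proof.
move=> eF; have := subsetP F_edges _ eF; rewrite inE => /cards2P[p [q [_ def_e]]].
rewrite /adj def_e in eF *; case/set2P=> ->; first by exists q.
by exists p; rewrite // setUC.
Qed.

(** Both sides count incident pairs of a vertex and an edge: the edges at [u]
    are the sets [[set u; v]] with [v] adjacent to [u]. *)
Lemma handshake : \sum_u \sum_v adj u v = 2 * #|F|.
Proof.
have deg u : \sum_v adj u v = \sum_(e in F) (u \in e).
  have -> : \sum_v adj u v = #|[set v | adj u v]|.
    by rewrite -sum1dep_card [in RHS]big_mkcond; apply: eq_bigr => v _; case: ifP.
  have -> : \sum_(e in F) (u \in e) = #|[set e in F | u \in e]|.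
    by rewrite -sum1dep_card [in RHS]big_mkcondr; apply: eq_bigr => e _; case: ifP.
  have -> : [set e in F | u \in e] = [set [set u; v] | v in [set v | adj u v]].
    apply/setP => e; rewrite inE; apply/andP/imsetP => [[eF ue]|[v]].
      by have [v -> uv] := edge_at eF ue; exists v; rewrite ?inE.
    by rewrite inE => uv ->; rewrite set21.
  rewrite card_in_imset // => v w; rewrite !inE => uv uw eq_vw.
  have /set2P[vu|//] : v \in [set u; w] by rewrite -eq_vw set22.
  by rewrite vu adj_irr in uv.
rewrite (eq_bigr _ (fun u _ => deg u)) exchange_big /= mulnC -sum_nat_const.
apply: eq_bigr => e /(subsetP F_edges); rewrite inE => /eqP <-.
by rewrite -sum1_card [in RHS]big_mkcond; apply: eq_bigr => u _; case: ifP.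
Qed.

End EdgeRelation.

Local Open Scope ring_scope.

Theorem lemma18 (a n : nat) (V : finType) (K : crg V)
  (ha : (2 <= a)%N) (hn : #|V| = n)
  (hK : forall A : {set V}, #|A| = a ->
          has_white_edge K A \/ has_black_spanning K A) :
  Num.ceil (n%:R / 2 * (n%:R - a%:R + 1) : rat)
    <= (a%:Z - 1) * #|EW K|%:Z + #|EB K|%:Z.
Proof.
have WE : EW K \subset edges V by apply/subsetP => e; rewrite inE => /andP[].
have BE : EB K \subset edges V by apply/subsetP => e; rewrite inE => /andP[].
have black_at (A : {set V}) : #|A| = a -> white_free (adj (EW K)) A ->
    forall x, x \in A -> exists2 y, y \in A & adj (EB K) x y.
  move=> /hK[[e eW eA]|bA] /white_freeP fA x xA.
    have : e \in edges V by exact: (subsetP WE).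
    rewrite inE => /cards2P[p [q [_ def_e]]]; rewrite def_e in eW eA.
    have := fA p q; rewrite /adj eW => /(_ _ _)/negP[] //;
      by apply: (subsetP eA); rewrite !inE eqxx ?orbT.
  move: (xA); rewrite -{1}bA => /bigcupP[e]; rewrite inE => /andP[eB eA] xe.
  have [y def_e xy] := edge_at BE eB xe; exists y => //.
  by apply: (subsetP eA); rewrite def_e set22.
have := weight_lower_bound (@adj_sym _ _) (@adj_sym _ _) (adj_irr WE)
  (adj_irr BE) black_at ha [set: V].
rewrite cardsT hn.
have -> : (\sum_(u in [set: V]) \sum_(v in [set: V])
    weight a (adj (EW K)) (adj (EB K)) u v = 2 * ((a - 1) * #|EW K| + #|EB K|))%N.
  rewrite mulnDr mulnCA -!handshake // big_distrr /= -big_split /=.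
  apply: eq_big => [u|u _]; first by rewrite inE.
  rewrite big_distrr /= -big_split /=.
  by apply: eq_bigl => v; rewrite inE.
move=> bound; rewrite ceil_le_int.
have {}bound : (n%:R * n%:R <= 2 * ((a%:R - 1) * #|EW K|%:R + #|EB K|%:R)
    + n%:R * (a%:R - 1) :> rat).
  by move: bound; rewrite -(ler_nat rat) !(natrD, natrM) natrB //; lia.
rewrite !(rmorphD, rmorphM, rmorphB) /= ; lra.
Qed.
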